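(* Let $c<1$, let $w=\sqrt{1-c}$, and let $G_c$ be the connected and simply connected Lie group whose Lie algebra $\mathfrak{g}_c$ has a basis $\{x,y,z\}$ with $[x,y]=0$, $[z,x]=y$, $[z,y]=-cx+2y$. Put $x_1=-(1-w)x+y$, $x_2=-(1+w)x+y$, $x_3=z$ (so $[x_1,x_2]=0$, $[x_3,x_1]=(1+w)x_1$, $[x_3,x_2]=(1-w)x_2$) and $$P=\begin{bmatrix}\frac1{2w}&\frac{1+w}{2w}&0\\-\frac1{2w}&\frac{w-1}{2w}&0\\0&0&1\end{bmatrix}.$$ Let $h$ be a left invariant Lorentzian metric on $G_c$ whose matrix with respect to $\{x,y,z\}$ is $[h]=P^tMP$ (equivalently, whose matrix with respect to $\{x_1,x_2,x_3\}$ is $M$). In each case below $\{y_1,y_2,y_3\}$ is an $h$-orthonormal basis of $\mathfrak{g}_c$, and the Ricci operator $\mathrm{Ric}$ of $h$ has the stated matrix with respect to it and the stated O'Neill type; throughout $\mu>0$. (1) If $M=\begin{bmatrix}0&0&1\\0&1&0\\1&0&0\end{bmatrix}$, and $y_1=x_2$, $y_2=\frac1{\sqrt2}(x_1+x_3)$, $y_3=\frac1{\sqrt2}(x_1-x_3)$, then $$[\mathrm{Ric}]_{\{y_i\}}=\begin{bmatrix}0&0&0\\0&-w(w-1)&w(w-1)\\0&-w(w-1)&w(w-1)\end{bmatrix},$$ and $\mathrm{Ric}$ is of O'Neill type $\{11,1\}$ or $\{21\}$ when $w=1$ or $w\ne1$, respectively. (2) If $M=\begin{bmatrix}1&0&0\\0&0&1\\0&1&0\end{bmatrix}$,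 and $y_1=x_1$, $y_2=\frac1{\sqrt2}(x_2+x_3)$, $y_3=\frac1{\sqrt2}(x_2-x_3)$, then $$[\mathrm{Ric}]_{\{y_i\}}=\begin{bmatrix}0&0&0\\0&-w(w+1)&w(w+1)\\0&-w(w+1)&w(w+1)\end{bmatrix}\quad(\text{O'Neill type }\{21\}).$$ (3) If $M=\begin{bmatrix}1&1&0\\1&1&\mu\\0&\mu&0\end{bmatrix}$, and $y_1=x_1$, $y_2=x_1-x_2-\frac1{2\mu}x_3$, $y_3=x_1-x_2+\frac1{2\mu}x_3$, then $$[\mathrm{Ric}]_{\{y_i\}}=\begin{bmatrix}-\frac{2w^2}{\mu^2}&\frac{w(1+w)}{\mu^2}&-\frac{w(1+w)}{\mu^2}\\\frac{w(1+w)}{\mu^2}&\frac{w(3w-1)}{2\mu^2}&\frac{w(1+w)}{2\mu^2}\\\frac{w(1+w)}{\mu^2}&-\frac{w(1+w)}{2\mu^2}&\frac{w(1+5w)}{2\mu^2}\end{bmatrix},$$ and $\mathrm{Ric}$ is of O'Neill type $\{11,1\}$ or $\{21\}$ when $w=1$ or $w\ne1$, respectively. (4) If $M=\begin{bmatrix}1&0&0\\0&1&0\\0&0&-\mu\end{bmatrix}$, and $y_1=x_1$, $y_2=x_2$, $y_3=\frac1{\sqrt\mu}x_3$, then $[\mathrm{Ric}]_{\{y_i\}}=\mathrm{diag}\{\frac{2(1+w)}\mu,\frac{2(1-w)}\mu,\frac{2(1+w^2)}\mu\}$ (O'Neill type $\{11,1\}$). (5) If $M=\begin{bmatrix}1&0&0\\0&-1&0\\0&0&\mu\end{bmatrix}$,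 and $y_1=x_1$, $y_2=\frac1{\sqrt\mu}x_3$, $y_3=x_2$, then $[\mathrm{Ric}]_{\{y_i\}}=\mathrm{diag}\{-\frac{2(1+w)}\mu,-\frac{2(1+w^2)}\mu,-\frac{2(1-w)}\mu\}$ (O'Neill type $\{11,1\}$). (6) If $M=\begin{bmatrix}-1&0&0\\0&1&0\\0&0&\mu\end{bmatrix}$, and $y_1=x_2$, $y_2=\frac1{\sqrt\mu}x_3$, $y_3=x_1$, then $[\mathrm{Ric}]_{\{y_i\}}=\mathrm{diag}\{\frac{2(w-1)}\mu,-\frac{2(1+w^2)}\mu,-\frac{2(1+w)}\mu\}$ (O'Neill type $\{11,1\}$). (7) If $M=\begin{bmatrix}0&1&0\\1&0&0\\0&0&\mu\end{bmatrix}$, and $y_1=\frac1{\sqrt\mu}x_3$, $y_2=\frac1{\sqrt2}(x_1+x_2)$, $y_3=\frac1{\sqrt2}(x_1-x_2)$, then $[\mathrm{Ric}]_{\{y_i\}}=\mathrm{diag}\{-\frac2\mu,-\frac2\mu,-\frac2\mu\}$ (O'Neill type $\{11,1\}$). (8) If $M=\begin{bmatrix}0&1&0\\1&1&0\\0&0&\mu\end{bmatrix}$, and $y_1=\frac1{\sqrt\mu}x_3$, $y_2=x_2$, $y_3=x_1-x_2$, then $$[\mathrm{Ric}]_{\{y_i\}}=\begin{bmatrix}-\frac2\mu&0&0\\0&-\frac{2(w^2-w+1)}\mu&\frac{2w(w-1)}\mu\\0&-\frac{2w(w-1)}\mu&\frac{2(w^2-w-1)}\mu\end{bmatrix},$$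 and $\mathrm{Ric}$ is of O'Neill type $\{11,1\}$ or $\{21\}$ when $w=1$ or $w\ne1$, respectively. (9) If $M=\begin{bmatrix}0&1&0\\1&-1&0\\0&0&\mu\end{bmatrix}$, and $y_1=\frac1{\sqrt\mu}x_3$, $y_2=x_1+x_2$, $y_3=x_2$, then $$[\mathrm{Ric}]_{\{y_i\}}=\begin{bmatrix}-\frac2\mu&0&0\\0&\frac{2(w^2-w-1)}\mu&\frac{2w(w-1)}\mu\\0&-\frac{2w(w-1)}\mu&-\frac{2(w^2-w+1)}\mu\end{bmatrix},$$ and $\mathrm{Ric}$ is of O'Neill type $\{11,1\}$ or $\{21\}$ when $w=1$ or $w\ne1$, respectively. (10-1) If $M=\begin{bmatrix}1&1&0\\1&\tau&0\\0&0&\nu\end{bmatrix}$ with $\nu>0$ and $\tau<1$, and $y_1=x_1$, $y_2=\frac1{\sqrt\nu}x_3$, $y_3=\frac1{\sqrt{1-\tau}}(x_1-x_2)$, then $$[\mathrm{Ric}]_{\{y_i\}}=\begin{bmatrix}-\frac{2(w^2+w+1-(1+w)\tau)}{\nu(1-\tau)}&0&-\frac{2w(1+w)}{\nu\sqrt{1-\tau}}\\0&\frac{2(w^2\tau+\tau-1)}{\nu(1-\tau)}&0\\\frac{2w(1+w)}{\nu\sqrt{1-\tau}}&0&\frac{2(w^2+w-1+(1-w)\tau)}{\nu(1-\tau)}\end{bmatrix},$$ and $\mathrm{Ric}$ is of O'Neill type $\{11,1\}$, $\{1z\bar z\}$, $\{21\}$ when $\tau(\tau-1+w^2)>0$, $<0$,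 $=0$, respectively. (10-2) If $M=\begin{bmatrix}1&1&0\\1&\tau&0\\0&0&\nu\end{bmatrix}$ with $\nu<0$ and $\tau>1$, and $y_1=x_1$, $y_2=\frac1{\sqrt{\tau-1}}(x_1-x_2)$, $y_3=\frac1{\sqrt{-\nu}}x_3$, then $$[\mathrm{Ric}]_{\{y_i\}}=\begin{bmatrix}\frac{2(w^2+w+1-(1+w)\tau)}{\nu(\tau-1)}&-\frac{2w(1+w)}{\nu\sqrt{\tau-1}}&0\\-\frac{2w(1+w)}{\nu\sqrt{\tau-1}}&-\frac{2(w^2+w-1+(1-w)\tau)}{\nu(\tau-1)}&0\\0&0&-\frac{2(w^2\tau+\tau-1)}{\nu(\tau-1)}\end{bmatrix}\quad(\text{O'Neill type }\{11,1\}).$$ (11) If $M=\begin{bmatrix}-1&1&0\\1&-\eta&0\\0&0&\mu\end{bmatrix}$ with $\eta<1$, and $y_1=\frac1{\sqrt\mu}x_3$, $y_2=\frac1{\sqrt{1-\eta}}(x_1+x_2)$, $y_3=x_1$, then $$[\mathrm{Ric}]_{\{y_i\}}=\begin{bmatrix}\frac{2(w^2\eta+\eta-1)}{\mu(1-\eta)}&0&0\\0&\frac{2(w^2+w-1+\eta-w\eta)}{\mu(1-\eta)}&\frac{2w(1+w)}{\mu\sqrt{1-\eta}}\\0&-\frac{2w(1+w)}{\mu\sqrt{1-\eta}}&-\frac{2(w^2+w+1-(1+w)\eta)}{\mu(1-\eta)}\end{bmatrix},$$ and $\mathrm{Ric}$ is of O'Neill type $\{11,1\}$, $\{1z\bar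 z\}$, $\{21\}$ when $\eta(\eta-1+w^2)>0$, $<0$, $=0$, respectively.
   Context: A left invariant Lorentzian metric $h$ on a connected three-dimensional Lie group $G$ is identified with a nondegenerate symmetric bilinear form of signature $(+,+,-)$ on its Lie algebra $\mathfrak{g}$; its matrix $[h]$ in a basis of $\mathfrak{g}$ satisfies $h(u,v)=[u]^t[h][v]$. A basis $\{y_1,y_2,y_3\}$ is $h$-orthonormal if $h(y_1,y_1)=h(y_2,y_2)=1$, $h(y_3,y_3)=-1$ and $h(y_i,y_j)=0$ for $i\ne j$. The Levi-Civita connection $\nabla:\mathfrak{g}\times\mathfrak{g}\to\mathfrak{g}$ is given by $2h(\nabla_uv,w)=h([u,v],w)+h([w,u],v)+h([w,v],u)$. The curvature is $R_{uv}=\nabla_{[u,v]}-(\nabla_u\nabla_v-\nabla_v\nabla_u)$, the Ricci curvature $\mathrm{ric}(u,v)$ is the trace of $w\mapsto R_{uw}v$, and the Ricci operator $\mathrm{Ric}:\mathfrak{g}\to\mathfrak{g}$ is defined by $h(\mathrm{Ric}(u),v)=\mathrm{ric}(u,v)$ (in this paragraph $u,v,w$ denote vectors of $\mathfrak{g}$; in the claim $w$ is the number $\sqrt{1-c}$). The $j$-th column of $[\mathrm{Ric}]_{\{y_i\}}$ is the coordinate vector of $\mathrm{Ric}(y_j)$. O'Neill types of an $h$-self-adjoint operator $T$ (matrix columns are images of basis vectors): type $\{11,1\}$ if $T$ has a diagonal matrix in some $h$-orthonormal basis; type $\{1z\bar z\}$ if in some $h$-orthonormal basis its matrix is $\begin{bmatrix}a&0&0\\0&\alpha&\beta\\0&-\beta&\alpha\end{bmatrix}$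 with $\beta\ne0$; type $\{21\}$ if in some basis $\{e,u,v\}$ whose only non-zero products are $h(e,e)=h(u,v)=1$ its matrix is $\begin{bmatrix}a&0&0\\0&b&\epsilon\\0&0&b\end{bmatrix}$ with $\epsilon=\pm1$. *)

(* Defs.v *)
From HB Require Import structures.
From mathcomp Require Import all_boot all_order all_algebra.
From mathcomp Require Import sesquilinear ring.
From mathcomp Require Import boolp classical_sets reals.

Set Implicit Arguments.
Unset Strict Implicit.
Unset Printing Implicit Defensive.

Import Order.TTheory GRing.Theory Num.Theory.
Local Open Scope ring_scope.
Local Open Scope classical_set_scope.

Definition mx3 (R : nzRingType) (rows : seq (seq R)) : 'M[R]_3 :=
  \matrix_(i, j) (nth [::] rows i)`_j.

Section Matrices.
Context {R : fieldType} {g : vectType R} {n : nat}.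
Implicit Type b : n.-tuple g.

(* Column j holds the coordinates of f b_j: this is the transpose of mxof. *)
Definition mx_op b (f : g -> g) : 'M[R]_n := \matrix_(i, j) coord b i (f b`_j).

Definition gram (h : g -> g -> R) b : 'M[R]_n := \matrix_(i, j) h b`_i b`_j.

End Matrices.

Definition op_trace (R : fieldType) (g : vectType R) (f : g -> g) : R :=
  \tr (mx_op (vbasis fullv) f).

Section Curvature.
Context {R : realType} {g : vectType R}.
Implicit Types u v w : g.

Definition lie_bracket (br : g -> g -> g) : Prop :=
  (forall u, br u u = 0) /\
  (forall u v w, br u (br v w) + br v (br w u) + br w (br u v) = 0).

(* The two definite descriptions below are meaningful for a Lorentzian h;
   see levi_civitaP and ricciP. *)
Definition levi_civita (br : g -> g -> g) (h : g -> g -> R) u v : g :=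
  xget 0 [set a | forall w,
    2 * h a w = h (br u v) w + h (br w u) v + h (br w v) u].

Definition curvature (br : g -> g -> g) (h : g -> g -> R) u v w : g :=
  let nabla := levi_civita br h in
  nabla (br u v) w - (nabla u (nabla v w) - nabla v (nabla u w)).

Definition ric (br : g -> g -> g) (h : g -> g -> R) u v : R :=
  op_trace (fun w => curvature br h u w v).

Definition ricci (br : g -> g -> g) (h : g -> g -> R) : 'End(g) :=
  linfun (fun u => xget 0 [set a | forall v, h a v = ric br h u v]).

Definition orthonormal_frame (h : g -> g -> R) (b : 3.-tuple g) : Prop :=
  basis_of fullv b /\
  gram h b = mx3 [:: [:: 1; 0; 0]; [:: 0; 1; 0]; [:: 0; 0; -1]].

Definition null_frame (h : g -> g -> R) (b : 3.-tuple g) : Prop :=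
  basis_of fullv b /\
  gram h b = mx3 [:: [:: 1; 0; 0]; [:: 0; 0; 1]; [:: 0; 1; 0]].

(* Signature (+,+,-); it forces g to be three-dimensional and h to be
   nondegenerate. *)
Definition lorentzian (h : {symmetric g}) : Prop :=
  exists b, orthonormal_frame h b.

(* Each of the three types forces T to be h-self-adjoint, because T is linear
   and the displayed matrix is self-adjoint for the displayed frame. *)
Definition oneill_11_1 (h : g -> g -> R) (T : 'End(g)) : Prop :=
  exists b, orthonormal_frame h b /\ is_diag_mx (mx_op b T).

Definition oneill_1zz (h : g -> g -> R) (T : 'End(g)) : Prop :=
  exists b, orthonormal_frame h b /\ exists a alpha beta : R,
    beta != 0 /\
    mx_op b T =
      mx3 [:: [:: a; 0; 0]; [:: 0; alpha; beta]; [:: 0; - beta; alpha]].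

Definition oneill_21 (h : g -> g -> R) (T : 'End(g)) : Prop :=
  exists b, null_frame h b /\ exists a b0 eps : R,
    (eps = 1 \/ eps = -1) /\
    mx_op b T = mx3 [:: [:: a; 0; 0]; [:: 0; b0; eps]; [:: 0; 0; b0]].

End Curvature.

Section Characterizations.
Context {R : realType} {g : vectType R}.
Variables (br : {bilinear g -> g -> g}) (h : {symmetric g}).
Hypothesis hL : lorentzian h.
Implicit Types u v w : g.

Lemma symC u v : h u v = h v u.
Proof. by rewrite hermC expr0 mul1r. Qed.

Lemma symDr u v w : h u (v + w) = h u v + h u w.
Proof. exact: linearDr. Qed.

Lemma symZr a u v : h u (a *: v) = a * h u v.
Proof. exact: linearZr_LR. Qed.

Lemma symDl u v w : h (u + v) w = h u w + h v w.
Proof. by rewrite symC symDr !(symC w). Qed.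

Lemma symZl a u v : h (a *: u) v = a * h u v.
Proof. by rewrite symC symZr symC. Qed.

Lemma brPl c u v w : br (c *: u + v) w = c *: br u w + br v w.
Proof. exact: linearPl. Qed.

Lemma brPr c u v w : br w (c *: u + v) = c *: br w u + br w v.
Proof. exact: linearPr. Qed.

Lemma sym_suml (F : 'I_3 -> g) v : h (\sum_i F i) v = \sum_i h (F i) v.
Proof. by rewrite symC linear_sumr; apply: eq_bigr => i _; rewrite symC. Qed.

Lemma orthonormal_frameE (b : 3.-tuple g) (i j : 'I_3) : orthonormal_frame h b ->
  h b`_i b`_j = (i == j)%:R * (if i == ord_max then -1 else 1).
Proof.
case=> _ /matrixP /(_ i j); rewrite !mxE => ->.
case: i => [[|[|[|//]]] Hi]; case: j => [[|[|[|//]]] Hj].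
all: by rewrite ?mul1r ?mul0r.
Qed.

Lemma lorentzian_inj u v : (forall w, h u w = h v w) -> u = v.
Proof.
case: hL => b hb huv; have bP := hb.1; apply/subr0_eq; set d := u - v.
have hd w : h d w = 0 by rewrite symDl -scaleN1r symZl huv mulN1r subrr.
rewrite (coord_basis bP (memvf d)) big1 // => i _.
suff -> : coord b i d = 0 by rewrite scale0r.
have := hd b`_i; rewrite {1}(coord_basis bP (memvf d)) sym_suml (bigD1 i) //=.
rewrite big1 => [|j ji]; rewrite symZl orthonormal_frameE //.
  rewrite eqxx mul1r addr0; case: ifP => _; last by rewrite mulr1.
  by rewrite mulrN1 => /eqP; rewrite oppr_eq0 => /eqP.
by rewrite (negPf ji) mul0r mulr0.
Qed.

Lemma lorentzian_riesz (phi : g -> R) :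
  scalar phi -> exists a, forall w, h a w = phi w.
Proof.
move=> phiL; case: hL => b hb; have bP := hb.1.
pose phi' : {linear g -> R^o} :=
  HB.pack phi (GRing.isLinear.Build R g R^o *:%R phi phiL).
exists (\sum_(i < 3) ((if i == ord_max then -1 else 1) * phi b`_i) *: b`_i) => w.
rewrite [in RHS](coord_basis bP (memvf w)) [RHS](linear_sum phi').
rewrite [in LHS](coord_basis bP (memvf w)) sym_suml; apply: eq_bigr => i _.
rewrite symZl linear_sumr (bigD1 i) //= big1 => [|j ji].
  rewrite symZr orthonormal_frameE // eqxx mul1r addr0.
  rewrite [RHS](linearZ_LR phi') -[RHS]/(coord b i w * phi b`_i).
  by case: ifP => _; ring.
by rewrite symZr orthonormal_frameE // eq_sym (negPf ji) mul0r mulr0.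
Qed.

Lemma levi_civitaP u v w :
  2 * h (levi_civita br h u v) w = h (br u v) w + h (br w u) v + h (br w v) u.
Proof.
rewrite /levi_civita; case: xgetP => [a _ /(_ w)//|no].
pose phi w := 2^-1 * (h (br u v) w + h (br w u) v + h (br w v) u).
have phiL : scalar phi.
  by move=> c s t; rewrite /phi !brPl !symDr !symDl !symZl !symZr; ring.
have [a aP] := lorentzian_riesz phiL.
by case: (no a) => /= t; rewrite aP mulVKf ?pnatr_eq0.
Qed.

Lemma levi_civita_eq u v a :
  (forall w, 2 * h a w = h (br u v) w + h (br w u) v + h (br w v) u) ->
  levi_civita br h u v = a.
Proof.
move=> aP; apply: lorentzian_inj => w; apply: (@mulfI _ 2); first by rewrite pnatr_eq0.
by rewrite levi_civitaP aP.
Qed.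

Lemma levi_civitaPl v : linear (levi_civita br h ^~ v).
Proof.
move=> c s t; apply: levi_civita_eq => w; rewrite symDl symZl mulrDr mulrCA.
by rewrite !levi_civitaP !(brPl, brPr) !symDl !symDr !symZl !symZr; ring.
Qed.

Lemma levi_civitaPr u : linear (levi_civita br h u).
Proof.
move=> c s t; apply: levi_civita_eq => w; rewrite symDl symZl mulrDr mulrCA.
by rewrite !levi_civitaP !(brPl, brPr) !symDl !symDr !symZl !symZr; ring.
Qed.

Lemma op_traceD c (f1 f2 : g -> g) :
  op_trace (fun w => c *: f1 w + f2 w) = c * op_trace f1 + op_trace f2.
Proof.
rewrite /op_trace /mxtrace mulr_sumr -big_split; apply: eq_bigr => i _.
by rewrite !mxE linearP.
Qed.

Lemma scaler_combBB c u1 u2 v1 v2 w1 w2 :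
  (c *: u1 + u2) - ((c *: v1 + v2) - (c *: w1 + w2)) =
  c *: (u1 - (v1 - w1)) + (u2 - (v2 - w2)).
Proof. by rewrite !scalerBr (opprD (c *: w1)) addrACA opprD addrACA. Qed.

Lemma ricPl v : scalar (ric br h ^~ v).
Proof.
move=> c s t; rewrite /ric -op_traceD; congr op_trace; apply/funext => w.
rewrite /curvature brPl !levi_civitaPl !levi_civitaPr.
exact: scaler_combBB.
Qed.

Lemma ricPr u : scalar (ric br h u).
Proof.
move=> c s t; rewrite /ric -op_traceD; congr op_trace; apply/funext => w.
rewrite /curvature !levi_civitaPr.
exact: scaler_combBB.
Qed.

Lemma ricciP u v : h (ricci br h u) v = ric br h u v.
Proof.
pose f u := xget 0 [set a | forall v, h a v = ric br h u v].
have fP s t : h (f s) t = ric br h s t.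
  rewrite /f; case: xgetP => [a _ /(_ t)//|no].
  by have [a aP] := lorentzian_riesz (ricPr s); case: (no a).
have fL : linear f.
  by move=> c s t; apply: lorentzian_inj => w; rewrite symDl symZl !fP ricPl.
pose f' : {linear g -> g} := HB.pack f (GRing.isLinear.Build R g g *:%R f fL).
by rewrite /ricci (lfunE f').
Qed.

End Characterizations.

(* Main.v *)
(* The Koszul formula expresses the Levi-Civita connection, hence the Ricci
   operator, in an orthonormal frame by polynomials in the structure constants,
   so each matrix of Ric reduces to the brackets of the y_i.  The O'Neill types
   come from the action of Ric on an invariant plane.  On a spacelike plane a
   rotation diagonalizes it.  On a Lorentzian plane, with block (p q; -q r), the
   sign of (p - r)^2 - 4 q^2 decides: a boost diagonalizes the block if it is
   positive and equalizes the diagonal entries if it is negative, and if it is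
   zero with q nonzero there is a null eigenvector, which completes to a null
   frame.  In case (3) a null rotation first produces such an invariant plane. *)

Require Import Defs.
From HB Require Import structures.
From mathcomp Require Import all_boot all_order all_algebra.
From mathcomp Require Import sesquilinear ring.
From mathcomp Require Import reals.

Set Implicit Arguments.
Unset Strict Implicit.
Unset Printing Implicit Defensive.

Import Order.TTheory GRing.Theory Num.Theory.
Local Open Scope ring_scope.

(** * Explicit three by three matrices *)

Section Mx3.
Context {R : comNzRingType}.

Lemma eq_mx3 (a b c d e f p q r a' b' c' d' e' f' p' q' r' : R) :
  a = a' -> b = b' -> c = c' -> d = d' -> e = e' -> f = f' ->
  p = p' -> q = q' -> r = r' ->
  mx3 [:: [:: a; b; c]; [:: d; e; f]; [:: p; q; r]] =
  mx3 [:: [:: a'; b'; c']; [:: d'; e'; f']; [:: p'; q'; r']].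
Proof. by move=> -> -> -> -> -> -> -> -> ->. Qed.

Lemma mx3_inj (a b c d e f p q r a' b' c' d' e' f' p' q' r' : R) :
  mx3 [:: [:: a; b; c]; [:: d; e; f]; [:: p; q; r]] =
  mx3 [:: [:: a'; b'; c']; [:: d'; e'; f']; [:: p'; q'; r']] ->
  [/\ a = a', b = b' & c = c'] /\ [/\ d = d', e = e' & f = f'] /\
  [/\ p = p', q = q' & r = r'].
Proof.
move=> /matrixP eqm; pose o i (lt_i3 : (i < 3)%N) := Ordinal lt_i3.
have := (eqm (o 0 isT) (o 0 isT), eqm (o 0 isT) (o 1 isT), eqm (o 0 isT) (o 2 isT),
  (eqm (o 1 isT) (o 0 isT), eqm (o 1 isT) (o 1 isT), eqm (o 1 isT) (o 2 isT)),
  (eqm (o 2 isT) (o 0 isT), eqm (o 2 isT) (o 1 isT), eqm (o 2 isT) (o 2 isT))).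
by rewrite !mxE /= => -[[[[? ?] ?] [[? ?] ?]] [[? ?] ?]].
Qed.

Lemma mx3E (A : 'M[R]_3) (E : nat -> nat -> R) :
  (forall i j : 'I_3, A i j = E i j) ->
  A = mx3 [:: [:: E 0 0; E 0 1; E 0 2]; [:: E 1 0; E 1 1; E 1 2];
              [:: E 2 0; E 2 1; E 2 2]]%N.
Proof.
move=> AE; apply/matrixP => i j; rewrite AE !mxE.
by case: i j => [[|[|[|//]]] Hi] [[|[|[|//]]] Hj].
Qed.

Lemma mx3M (a b c d e f p q r a' b' c' d' e' f' p' q' r' : R) :
  mx3 [:: [:: a; b; c]; [:: d; e; f]; [:: p; q; r]] *m
  mx3 [:: [:: a'; b'; c']; [:: d'; e'; f']; [:: p'; q'; r']] =
  mx3 [:: [:: a * a' + b * d' + c * p'; a * b' + b * e' + c * q';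
              a * c' + b * f' + c * r'];
          [:: d * a' + e * d' + f * p'; d * b' + e * e' + f * q';
              d * c' + e * f' + f * r'];
          [:: p * a' + q * d' + r * p'; p * b' + q * e' + r * q';
              p * c' + q * f' + r * r']].
Proof.
apply/matrixP => i j; rewrite !mxE !big_ord_recl big_ord0 !mxE /= addr0.
by case: i j => [[|[|[|//]]] Hi] [[|[|[|//]]] Hj] /=; rewrite addrA.
Qed.

Lemma mx3T (a b c d e f p q r : R) :
  (mx3 [:: [:: a; b; c]; [:: d; e; f]; [:: p; q; r]])^T =
  mx3 [:: [:: a; d; p]; [:: b; e; q]; [:: c; f; r]].
Proof.
apply/matrixP => i j; rewrite !mxE.
by case: i j => [[|[|[|//]]] Hi] [[|[|[|//]]] Hj].
Qed.

Lemma mx3_diag (a b c : R) :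
  is_diag_mx (mx3 [:: [:: a; 0; 0]; [:: 0; b; 0]; [:: 0; 0; c]]).
Proof.
apply/is_diag_mxP => i j; rewrite !mxE.
by case: i j => [[|[|[|//]]] Hi] [[|[|[|//]]] Hj].
Qed.

End Mx3.

Lemma mx3_1 {R : comNzRingType} :
  1%:M = mx3 [:: [:: 1; 0; 0]; [:: 0; 1; 0]; [:: 0; 0; 1]] :> 'M[R]_3.
Proof.
apply/matrixP => i j; rewrite !mxE.
by case: i j => [[|[|[|//]]] Hi] [[|[|[|//]]] Hj].
Qed.

(** Both traces equal the double sum of [coord b' j b_i * coord b i (f b'_j)]. The lengths [m] and
    [n] are kept apart because [vbasis fullv], on which [op_trace] is built, has length
    [\dim fullv], which is not literally 3. *)
Lemma mxtrace_mx_op (R : fieldType) (g : vectType R) m n (b : m.-tuple g)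
    (b' : n.-tuple g) (f : {linear g -> g}) :
  basis_of fullv b -> basis_of fullv b' -> \tr (mx_op b f) = \tr (mx_op b' f).
Proof.
move=> bP b'P; rewrite /mxtrace.
have -> : \sum_i mx_op b f i i =
    \sum_(i < m) \sum_(j < n) coord b' j b`_i * coord b i (f b'`_j).
  apply: eq_bigr => i _; rewrite mxE {1}(coord_basis b'P (memvf b`_i)).
  by rewrite !linear_sum; apply: eq_bigr => j _; rewrite !linearZ.
rewrite exchange_big; apply: eq_bigr => j _; rewrite mxE.
rewrite {2}(coord_basis bP (memvf (f b'`_j))) linear_sum.
by apply: eq_bigr => i _; rewrite linearZ /= mulrC.
Qed.

(** * Gram matrices and changes of frame *)

Section Metric.
Context {R : realType} {g : vectType R}.
Variable h : {symmetric g}.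
Implicit Types (u v : g) (T : 'End(g)).

Lemma symNl u v : h (- u) v = - h u v.
Proof. by rewrite -scaleN1r symZl mulN1r. Qed.

Lemma symNr u v : h u (- v) = - h u v.
Proof. by rewrite -scaleN1r symZr mulN1r. Qed.

Lemma sym0l u : h 0 u = 0.
Proof. by rewrite -(scale0r 0) symZl mul0r. Qed.

Lemma sym0r u : h u 0 = 0.
Proof. by rewrite symC sym0l. Qed.

Definition symE := (symDl h, symDr h, symNl, symNr, symZl h, symZr h, sym0l, sym0r).

Lemma form_sumr I (r : seq I) (F : I -> g) v :
  h v (\sum_(i <- r) F i) = \sum_(i <- r) h v (F i).
Proof. exact: (big_morph (h v) (symDr h v) (sym0r v)). Qed.

Lemma form_suml I (r : seq I) (F : I -> g) v :
  h (\sum_(i <- r) F i) v = \sum_(i <- r) h (F i) v.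
Proof. by rewrite symC form_sumr; apply: eq_bigr => i _; rewrite symC. Qed.

Lemma gram3E (e1 e2 e3 : g) :
  gram h [tuple e1; e2; e3] =
  mx3 [:: [:: h e1 e1; h e1 e2; h e1 e3]; [:: h e2 e1; h e2 e2; h e2 e3];
          [:: h e3 e1; h e3 e2; h e3 e3]].
Proof.
apply: (@mx3E _ _ (fun i j => h [:: e1; e2; e3]`_i [:: e1; e2; e3]`_j)) => i j.
by rewrite mxE.
Qed.

Lemma gram3_inj (e1 e2 e3 : g) (a b c d e f p q r : R) :
  gram h [tuple e1; e2; e3] =
    mx3 [:: [:: a; b; c]; [:: d; e; f]; [:: p; q; r]] ->
  [/\ h e1 e1 = a, h e1 e2 = b & h e1 e3 = c] /\
  [/\ h e2 e1 = d, h e2 e2 = e & h e2 e3 = f] /\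
  [/\ h e3 e1 = p, h e3 e2 = q & h e3 e3 = r].
Proof. by rewrite gram3E => /mx3_inj. Qed.

(** The coefficients of a vanishing combination form a row vector killed by the invertible Gram
    matrix, so the family is free; its size is the dimension. *)
Lemma gram_basis n (b : n.-tuple g) :
  \dim {:g} = n -> gram h b \in unitmx -> basis_of fullv b.
Proof.
move=> dimg Gu; rewrite basisEfree subvf size_tuple dimg leqnn !andbT.
apply/freeP => k kb0 i; pose kv := \row_j k j.
suff /rowP/(_ i) : kv = 0 by rewrite !mxE.
apply: (can_inj (mulmxK Gu)); rewrite mul0mx; apply/rowP => j.
rewrite !mxE; under eq_bigr do rewrite !mxE -symZl.
by rewrite -form_suml kb0 sym0l.
Qed.

(** Column [j] of [Q] holds the coordinates of the new vector [b'_j]. Invertibility of [G] makes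
    [b'] a basis and [Q] invertible. Stating the conjugation as [mx_op b T *m Q = Q *m A] avoids
    inverse matrices, so explicit instances are checked entry by entry. *)
Lemma frame_change n (b : n.-tuple g) T (Q G A : 'M[R]_n) :
    basis_of fullv b -> G \in unitmx -> Q^T *m gram h b *m Q = G ->
    mx_op b T *m Q = Q *m A ->
  exists b' : n.-tuple g,
    [/\ basis_of fullv b', gram h b' = G & mx_op b' T = A].
Proof.
move=> bP Gu QG TQ; pose b' := [tuple \sum_i Q i j *: b`_i | j < n].
have b'E (j : 'I_n) : b'`_j = \sum_i Q i j *: b`_i.
  by rewrite -tnth_nth tnth_mktuple.
have gramb' : gram h b' = G.
  rewrite -QG; apply/matrixP => i j; rewrite !mxE !b'E form_sumr.
  apply: eq_bigr => l _; rewrite symZr mulrC form_suml mxE; congr (_ * _).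
  by apply: eq_bigr => m _; rewrite symZl !mxE.
have b'P : basis_of fullv b' by apply: gram_basis; rewrite ?(size_basis bP) ?gramb'.
exists b'; split=> //.
have Qu : Q \in unitmx.
  by move: Gu; rewrite -QG unitmx_mul => /andP[].
(* After multiplication by [Q], both sides list the coordinates in [b] of [T b'_j]. *)
apply: (can_inj (mulKmx Qu)); rewrite -TQ; apply/matrixP => i j.
have coordb v : coord b i v = \sum_k Q i k * coord b' k v.
  rewrite {1}(coord_basis b'P (memvf v)) linear_sum; apply: eq_bigr => k _.
  rewrite linearZ b'E linear_sum (bigD1 i) //= big1 => [|l li].
    by rewrite linearZ /= coord_free ?(basis_free bP) // eqxx mulr1 addr0 mulrC.
  by rewrite linearZ /= coord_free ?(basis_free bP) //= (negPf li) mulr0.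
rewrite !mxE; under eq_bigr do rewrite mxE; rewrite -coordb b'E.
rewrite !linear_sum; apply: eq_bigr => k _.
by rewrite !linearZ mxE mulrC.
Qed.

End Metric.

(** * Orthonormal frames *)

Lemma unitmx_minkowski {R : comUnitRingType} :
  mx3 [:: [:: 1; 0; 0]; [:: 0; 1; 0]; [:: 0; 0; -1]] \in @unitmx R 3.
Proof.
set J := mx3 _; suff /mulmx1_unit[] : J *m J = 1%:M by [].
by rewrite mx3M mx3_1; apply: eq_mx3; ring.
Qed.

Lemma unitmx_null {R : comUnitRingType} :
  mx3 [:: [:: 1; 0; 0]; [:: 0; 0; 1]; [:: 0; 1; 0]] \in @unitmx R 3.
Proof.
set J := mx3 _; suff /mulmx1_unit[] : J *m J = 1%:M by [].
by rewrite mx3M mx3_1; apply: eq_mx3; ring.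
Qed.

Section Frame.
Context {R : realType} {g : vectType R}.
Variable h : {symmetric g}.
Hypothesis hL : lorentzian h.
Implicit Types (u v : g) (T : 'End(g)).

Lemma lorentzian_dim : \dim {:g} = 3.
Proof. by case: hL => b [/size_basis]. Qed.

Lemma orthonormal_frameI (e1 e2 e3 : g) :
  h e1 e1 = 1 -> h e2 e2 = 1 -> h e3 e3 = -1 ->
  h e1 e2 = 0 -> h e1 e3 = 0 -> h e2 e3 = 0 ->
  orthonormal_frame h [tuple e1; e2; e3].
Proof.
move=> h11 h22 h33 h12 h13 h23.
have G : gram h [tuple e1; e2; e3] =
    mx3 [:: [:: 1; 0; 0]; [:: 0; 1; 0]; [:: 0; 0; -1]].
  by rewrite gram3E (symC h e2 e1) !(symC h e3 _) h11 h22 h33 h12 h13 h23.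
split=> //; apply: (@gram_basis _ _ h); first exact: lorentzian_dim.
by rewrite G unitmx_minkowski.
Qed.

(** The index [ord_max] is the timelike one; its sign is the inverse of [h b_i b_i]. *)
Lemma coord_orthonormal (b : 3.-tuple g) v (i : 'I_3) : orthonormal_frame h b ->
  coord b i v = (if i == ord_max then -1 else 1) * h v b`_i.
Proof.
move=> hb; rewrite {2}(coord_basis hb.1 (memvf v)) form_suml (bigD1 i) //=.
rewrite big1 => [|j ji]; rewrite symZl orthonormal_frameE //.
  by rewrite eqxx mul1r addr0; case: ifP => _; ring.
by rewrite (negPf ji) mul0r mulr0.
Qed.

Lemma orthonormal_frame_expand (b : 3.-tuple g) v : orthonormal_frame h b ->
  v = h v b`_0 *: b`_0 + h v b`_1 *: b`_1 - h v b`_2 *: b`_2.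
Proof.
move=> hb; rewrite {1}(coord_basis hb.1 (memvf v)).
under eq_bigr do rewrite coord_orthonormal //.
by rewrite !big_ord_recl big_ord0 /= !mul1r mulN1r scaleNr addr0 addrA.
Qed.

Lemma mx_op_orthonormal (e1 e2 e3 : g) (f : g -> g) :
  orthonormal_frame h [tuple e1; e2; e3] ->
  mx_op [tuple e1; e2; e3] f =
  mx3 [:: [:: h (f e1) e1; h (f e2) e1; h (f e3) e1];
          [:: h (f e1) e2; h (f e2) e2; h (f e3) e2];
          [:: - h (f e1) e3; - h (f e2) e3; - h (f e3) e3]].
Proof.
move=> hb; apply/matrixP => i j; rewrite !mxE coord_orthonormal //.
by case: i j => [[|[|[|//]]] Hi] [[|[|[|//]]] Hj]; rewrite /= ?mul1r ?mulN1r.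
Qed.

End Frame.

(** * The Ricci operator in an orthonormal frame *)

Section Curvature.
Context {R : realType} {g : vectType R}.
Variables (br : {bilinear g -> g -> g}) (h : {symmetric g}).
Hypothesis hL : lorentzian h.
Hypothesis br_alt : forall u, br u u = 0.
Implicit Types u v : g.

Lemma brDl u v w : br (u + v) w = br u w + br v w.
Proof. exact: linearDl. Qed.

Lemma brDr u v w : br w (u + v) = br w u + br w v.
Proof. exact: linearDr. Qed.

Lemma brZl c u w : br (c *: u) w = c *: br u w.
Proof. exact: linearZl_LR. Qed.

Lemma brZr c u w : br w (c *: u) = c *: br w u.
Proof. exact: linearZr_LR. Qed.

Lemma brNl u w : br (- u) w = - br u w.
Proof. exact: linearNl. Qed.

Lemma brNr u w : br w (- u) = - br w u.
Proof. exact: linearNr. Qed.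

Definition brE := (brDl, brDr, brNl, brNr, brZl, brZr).

Lemma br_anti u v : br v u = - br u v.
Proof.
have := br_alt (u + v); rewrite brDl !brDr !br_alt add0r addr0 => /eqP.
by rewrite addrC addr_eq0 => /eqP.
Qed.

Local Notation nabla := (levi_civita br h).

Lemma levi_civitaDl u v w : nabla (u + v) w = nabla u w + nabla v w.
Proof. by have := levi_civitaPl br hL w 1 u v; rewrite !scale1r. Qed.

Lemma levi_civitaDr u v w : nabla w (u + v) = nabla w u + nabla w v.
Proof. by have := levi_civitaPr br hL w 1 u v; rewrite !scale1r. Qed.

Lemma levi_civita0l w : nabla 0 w = 0.
Proof. by have := levi_civitaPl br hL w (-1) 0 0; rewrite !scaleN1r !addNr. Qed.

Lemma levi_civita0r w : nabla w 0 = 0.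
Proof. by have := levi_civitaPr br hL w (-1) 0 0; rewrite !scaleN1r !addNr. Qed.

Lemma levi_civitaZl a u w : nabla (a *: u) w = a *: nabla u w.
Proof.
by have := levi_civitaPl br hL w a u 0; rewrite !addr0 levi_civita0l addr0.
Qed.

Lemma levi_civitaZr a u w : nabla w (a *: u) = a *: nabla w u.
Proof.
by have := levi_civitaPr br hL w a u 0; rewrite !addr0 levi_civita0r addr0.
Qed.

Lemma levi_civitaNl u w : nabla (- u) w = - nabla u w.
Proof. by rewrite -scaleN1r levi_civitaZl scaleN1r. Qed.

Lemma levi_civitaNr u w : nabla w (- u) = - nabla w u.
Proof. by rewrite -scaleN1r levi_civitaZr scaleN1r. Qed.

Definition levi_civitaE := (levi_civitaDl, levi_civitaDr, levi_civitaNl,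
  levi_civitaNr, levi_civitaZl, levi_civitaZr, levi_civita0l, levi_civita0r).

Lemma curvaturePr u v : linear (fun w => curvature br h u w v).
Proof.
move=> c s t; rewrite /curvature brPr !(levi_civitaPl, levi_civitaPr) //.
exact: scaler_combBB.
Qed.

(** The trace does not depend on the basis, so it may be taken in the frame, where the diagonal
    entries are products with the frame vectors and the timelike one enters with a minus sign. *)
Lemma ric_orthonormal (e1 e2 e3 : g) u v :
  orthonormal_frame h [tuple e1; e2; e3] ->
  ric br h u v = h (curvature br h u e1 v) e1 + h (curvature br h u e2 v) e2
    - h (curvature br h u e3 v) e3.
Proof.
move=> hb; pose f : {linear g -> g} := HB.pack (fun w => curvature br h u w v)
  (GRing.isLinear.Build R g g *:%R _ (curvaturePr u v)).
rewrite /ric /op_trace.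
rewrite (mxtrace_mx_op f (vbasisP _) hb.1).
by rewrite (mx_op_orthonormal _ hb) /mxtrace !big_ord_recl big_ord0 !mxE /= addr0 addrA.
Qed.

(** Both sides of the Koszul formula are linear in the test vector, so three test vectors
    suffice. *)
Lemma levi_civita_frame (e1 e2 e3 u v a : g) :
  orthonormal_frame h [tuple e1; e2; e3] ->
  let koszul w := h (br u v) w + h (br w u) v + h (br w v) u in
  2 * h a e1 = koszul e1 -> 2 * h a e2 = koszul e2 -> 2 * h a e3 = koszul e3 ->
  nabla u v = a.
Proof.
move=> hb koszul k1 k2 k3; apply: levi_civita_eq => // w.
rewrite (orthonormal_frame_expand w hb) /= !(brE, symE) !mulrDr mulrN.
rewrite !(mulrCA 2) k1 k2 k3 /koszul; ring.
Qed.

(** The [a_i], [b_i], [c_i] are the coordinates of [[e1, e2]], [[e1, e3]], [[e2, e3]]; the third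
    product is negated because [h e3 e3 = -1]. Entries are kept as the trace produces them: those at
    (1,2) and (2,1), for instance, agree only modulo the Jacobi identity. *)
Lemma ricci_orthonormal (e1 e2 e3 : g) (a1 a2 a3 b1 b2 b3 c1 c2 c3 : R) :
  orthonormal_frame h [tuple e1; e2; e3] ->
  [/\ h (br e1 e2) e1 = a1, h (br e1 e2) e2 = a2 & h (br e1 e2) e3 = - a3] ->
  [/\ h (br e1 e3) e1 = b1, h (br e1 e3) e2 = b2 & h (br e1 e3) e3 = - b3] ->
  [/\ h (br e2 e3) e1 = c1, h (br e2 e3) e2 = c2 & h (br e2 e3) e3 = - c3] ->
  mx_op [tuple e1; e2; e3] (ricci br h) =
  mx3 [:: [:: - a1 ^+ 2 + a1 * c3 - a2 ^+ 2 + a3 ^+ 2 / 2 - a3 * b2 + b1 ^+ 2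
                + b1 * c2 + b2 ^+ 2 / 2 - b3 ^+ 2 - c1 ^+ 2 / 2;
              a2 * c3 - a3 * c2 + b1 * c1 + b2 * c2 - b3 * c3;
              a1 * c1 + a2 * c2 - a3 * c3 + b2 * c3 - b3 * c2];
          [:: - a1 * b3 + a3 * b1 + b1 * c1 + b2 * c2 - b3 * c3;
              - a1 ^+ 2 - a2 ^+ 2 - a2 * b3 + a3 ^+ 2 / 2 + a3 * c1 + b1 * c2
                - b2 ^+ 2 / 2 + c1 ^+ 2 / 2 + c2 ^+ 2 - c3 ^+ 2;
              - a1 * b1 - a2 * b2 + a3 * b3 - b1 * c3 + b3 * c1];
          [:: - a1 * b2 - a1 * c1 + a2 * b1 - a2 * c2 + a3 * c3;
              a1 * b1 - a1 * c2 + a2 * b2 + a2 * c1 - a3 * b3;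
              a1 * c3 - a2 * b3 - a3 ^+ 2 / 2 + b1 ^+ 2 + b2 ^+ 2 / 2 + b2 * c1
                - b3 ^+ 2 + c1 ^+ 2 / 2 + c2 ^+ 2 - c3 ^+ 2]].
Proof.
move=> hb [A1 A2 A3] [B1 B2 B3] [C1 C2 C3].
have b12 : br e1 e2 = a1 *: e1 + a2 *: e2 + a3 *: e3.
  by rewrite [LHS](orthonormal_frame_expand _ hb) /= A1 A2 A3 scaleNr opprK.
have b13 : br e1 e3 = b1 *: e1 + b2 *: e2 + b3 *: e3.
  by rewrite [LHS](orthonormal_frame_expand _ hb) /= B1 B2 B3 scaleNr opprK.
have b23 : br e2 e3 = c1 *: e1 + c2 *: e2 + c3 *: e3.
  by rewrite [LHS](orthonormal_frame_expand _ hb) /= C1 C2 C3 scaleNr opprK.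
have b21 := br_anti e1 e2; have b31 := br_anti e1 e3.
have b32 := br_anti e2 e3.
have /gram3_inj[[h11 h12 h13] [[h21 h22 h23] [h31 h32 h33]]] := hb.2.
pose hE := (h11, h12, h13, (h21, h22, h23), (h31, h32, h33)).
pose bE := (br_alt, b21, b31, b32, b12, b13, b23).
(* The nine values are the solutions of the Koszul formula, each checked against the three frame
   vectors. *)
have n11 : nabla e1 e1 = - a1 *: e2 + b1 *: e3.
  by apply: (levi_civita_frame hb); rewrite !bE !symE !hE; field.
have n12 : nabla e1 e2 = a1 *: e1 + ((a3 + b2 + c1) / 2) *: e3.
  by apply: (levi_civita_frame hb); rewrite !bE !symE !hE; field.
have n13 : nabla e1 e3 = b1 *: e1 + ((a3 + b2 + c1) / 2) *: e2.
  by apply: (levi_civita_frame hb); rewrite !bE !symE !hE; field.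
have n21 : nabla e2 e1 = - a2 *: e2 + ((- a3 + b2 + c1) / 2) *: e3.
  by apply: (levi_civita_frame hb); rewrite !bE !symE !hE; field.
have n22 : nabla e2 e2 = a2 *: e1 + c2 *: e3.
  by apply: (levi_civita_frame hb); rewrite !bE !symE !hE; field.
have n23 : nabla e2 e3 = ((- a3 + b2 + c1) / 2) *: e1 + c2 *: e2.
  by apply: (levi_civita_frame hb); rewrite !bE !symE !hE; field.
have n31 : nabla e3 e1 = ((a3 - b2 + c1) / 2) *: e2 - b3 *: e3.
  by apply: (levi_civita_frame hb); rewrite !bE !symE !hE; field.
have n32 : nabla e3 e2 = ((- a3 + b2 - c1) / 2) *: e1 - c3 *: e3.
  by apply: (levi_civita_frame hb); rewrite !bE !symE !hE; field.
have n33 : nabla e3 e3 = - b3 *: e1 - c3 *: e2.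
  by apply: (levi_civita_frame hb); rewrite !bE !symE !hE; field.
pose nE := (n11, n12, n13, (n21, n22, n23), (n31, n32, n33)).
rewrite (mx_op_orthonormal _ hb).
apply: eq_mx3; rewrite ricciP // (ric_orthonormal _ _ hb) /curvature.
all: by rewrite !bE !levi_civitaE !nE !levi_civitaE !nE !symE !hE; field.
Qed.

End Curvature.

(** * O'Neill types *)

Section PlaneIsometries.
Context {R : realType}.
Implicit Types d q x : R.

Lemma pos_square x : 0 < x -> exists s, [/\ 0 < s, x = s ^+ 2 & Num.sqrt x = s].
Proof. by move=> x0; exists (Num.sqrt x); rewrite sqrtr_gt0 x0 sqr_sqrtr ?ltW. Qed.

(** The sign [eps] becomes the one in type {21}, and [s] rescales the null vectors. *)
Lemma neq0_square x : x != 0 ->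
  exists s eps, [/\ s != 0, eps = 1 \/ eps = -1 & x = eps * s ^+ 2].
Proof.
rewrite neq_lt => /orP[xlt0|/pos_square[s [s0 -> _]]]; last first.
  by exists s, 1; split; [rewrite gt_eqF|left|rewrite mul1r].
have [|s [s0 xs _]] := @pos_square (- x); first by rewrite oppr_gt0.
by exists s, (-1); split; [rewrite gt_eqF|right|rewrite mulN1r -xs opprK].
Qed.

(** [C] and [S] are a hyperbolic cosine and sine. With [d = p - r], the second equation says that
    the boost kills the off-diagonal entry of the block (p q; -q r). *)
Lemma boost_exists d q : 4 * q ^+ 2 < d ^+ 2 ->
  exists C S, C ^+ 2 - S ^+ 2 = 1 /\ d * C * S + q * (C ^+ 2 + S ^+ 2) = 0.
Proof.
(* Negating both [d] and [q] keeps the solutions; [0 <= d] makes [d + D] positive, so that [t] below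
   is defined even for [q = 0]. *)
wlog d0 : d q / 0 <= d => [hw|] qd.
  have [/hw/(_ qd) //|d0] := leP 0 d.
  have [||C [S [CS dq]]] := hw (- d) (- q); rewrite ?sqrrN ?oppr_ge0 1?ltW //.
  by exists C, S; split=> //; apply: oppr_inj; rewrite oppr0 -dq; ring.
have [|D [D0 qdD _]] := @pos_square (d ^+ 2 - 4 * q ^+ 2); first by rewrite subr_gt0.
(* [t = S / C] is the root of [q t^2 + d t + q] with [|t| < 1]. *)
pose t := - (2 * q) / (d + D).
have dD0 : d + D != 0 by rewrite gt_eqF // ltr_wpDl.
have [|n [n0 tn _]] := @pos_square (1 - t ^+ 2).
  have -> : 1 - t ^+ 2 = 2 * D / (d + D).
    apply/subr0_eq; transitivity ((d ^+ 2 - 4 * q ^+ 2 - D ^+ 2) / (d + D) ^+ 2).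
      by rewrite /t; field.
    by rewrite qdD subrr mul0r.
  by rewrite divr_gt0 ?mulr_gt0 // ltr_wpDl.
have n_neq0 : n != 0 by rewrite gt_eqF.
exists n^-1, (t / n); split.
  transitivity ((1 - t ^+ 2) / n ^+ 2); first by field.
  by rewrite tn mulfV ?expf_neq0.
have : q * t ^+ 2 + d * t + q = 0.
  transitivity (q * (D ^+ 2 - (d ^+ 2 - 4 * q ^+ 2)) / (d + D) ^+ 2).
    by rewrite /t; field.
  by rewrite qdD subrr mulr0 mul0r.
move=> qt; transitivity ((q * t ^+ 2 + d * t + q) / n ^+ 2); first by field.
by rewrite qt mul0r.
Qed.

(** This is the diagonalization of a symmetric block with [d = p - r]: the discriminant
    [d^2 + 4 q^2] is positive as soon as [q] is nonzero. *)
Lemma rotation_exists d q :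
  exists C S, C ^+ 2 + S ^+ 2 = 1 /\ d * C * S = q * (C ^+ 2 - S ^+ 2).
Proof.
have [->|q0] := eqVneq q 0; first by exists 1, 0; split; ring.
have [|D [D0 qdD _]] := @pos_square (d ^+ 2 + 4 * q ^+ 2).
  by rewrite ltr_wpDl ?sqr_ge0 // mulr_gt0 // lt_neqAle sqr_ge0 eq_sym sqrf_eq0 q0.
(* [t = S / C] is a root of [q t^2 + d t - q]. *)
pose t := (D - d) / (2 * q).
have [|n [n0 tn _]] := @pos_square (1 + t ^+ 2); first by rewrite ltr_pwDl ?sqr_ge0.
have n_neq0 : n != 0 by rewrite gt_eqF.
exists n^-1, (t / n); split.
  transitivity ((1 + t ^+ 2) / n ^+ 2); first by field.
  by rewrite tn mulfV ?expf_neq0.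
have qt : d * t = q * (1 - t ^+ 2).
  apply/eqP; rewrite -subr_eq0; apply/eqP.
  have -> : d * t - q * (1 - t ^+ 2) = (D ^+ 2 - (d ^+ 2 + 4 * q ^+ 2)) / (4 * q).
    by rewrite /t; field.
  by rewrite qdD subrr mul0r.
transitivity (d * t / n ^+ 2); first by field.
by rewrite qt; field.
Qed.

End PlaneIsometries.

Section ONeill.
Context {R : realType} {g : vectType R}.
Variables (h : {symmetric g}) (T : 'End(g)).
Implicit Types (b : 3.-tuple g) (a p q r : R).

Local Notation J := (mx3 [:: [:: 1; 0; 0]; [:: 0; 1; 0]; [:: 0; 0; -1]]).

Lemma orthonormal_change b (Q A : 'M[R]_3) :
    orthonormal_frame h b -> Q^T *m J *m Q = J -> mx_op b T *m Q = Q *m A ->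
  exists b', orthonormal_frame h b' /\ mx_op b' T = A.
Proof.
move=> [bP Gb] QJ TQ.
have QG : Q^T *m gram h b *m Q = J by rewrite Gb.
have [b' [? ? ?]] := frame_change bP unitmx_minkowski QG TQ.
by exists b'.
Qed.

Lemma boost_frame b a p q r C S :
    orthonormal_frame h b ->
    mx_op b T = mx3 [:: [:: a; 0; 0]; [:: 0; p; q]; [:: 0; - q; r]] ->
    C ^+ 2 - S ^+ 2 = 1 ->
    let q' := (p - r) * C * S + q * (C ^+ 2 + S ^+ 2) in
  exists b', orthonormal_frame h b' /\ mx_op b' T =
    mx3 [:: [:: a; 0; 0];
            [:: 0; p * C ^+ 2 + 2 * q * C * S - r * S ^+ 2; q'];
            [:: 0; - q'; r * C ^+ 2 - 2 * q * C * S - p * S ^+ 2]].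
Proof.
(* Inserting the factor [C^2 - S^2], equal to 1, gives both sides the same degree in [C] and [S],
   after which they agree as polynomials. *)
move=> hb Tb CS q'; have mulCS x : x = x * (C ^+ 2 - S ^+ 2) by rewrite CS mulr1.
pose Q := mx3 [:: [:: 1; 0; 0]; [:: 0; C; S]; [:: 0; S; C]].
apply: (orthonormal_change hb (Q := Q)).
  rewrite mx3T !mx3M; apply: eq_mx3; try ring; rewrite [RHS]mulCS; ring.
rewrite Tb !mx3M /q'; apply: eq_mx3; try ring; rewrite [LHS]mulCS; ring.
Qed.

Lemma rotation_frame b a p q r C S :
    orthonormal_frame h b ->
    mx_op b T = mx3 [:: [:: p; q; 0]; [:: q; r; 0]; [:: 0; 0; a]] ->
    C ^+ 2 + S ^+ 2 = 1 ->
    let q' := q * (C ^+ 2 - S ^+ 2) - (p - r) * C * S in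
  exists b', orthonormal_frame h b' /\ mx_op b' T =
    mx3 [:: [:: p * C ^+ 2 + 2 * q * C * S + r * S ^+ 2; q'; 0];
            [:: q'; r * C ^+ 2 - 2 * q * C * S + p * S ^+ 2; 0];
            [:: 0; 0; a]].
Proof.
move=> hb Tb CS q'; have mulCS x : x = x * (C ^+ 2 + S ^+ 2) by rewrite CS mulr1.
pose Q := mx3 [:: [:: C; - S; 0]; [:: S; C; 0]; [:: 0; 0; 1]].
apply: (orthonormal_change hb (Q := Q)).
  rewrite mx3T !mx3M; apply: eq_mx3; try ring; rewrite [RHS]mulCS; ring.
rewrite Tb !mx3M /q'; apply: eq_mx3; try ring; rewrite [LHS]mulCS; ring.
Qed.

(** The new frame is [(e2, e1, -e3)]: it moves an invariant Lorentzian plane spanned by [e1, e3] to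
    the last two places, and the sign of [e3] restores that of [q]. *)
Lemma swap_frame b a p q r :
    orthonormal_frame h b ->
    mx_op b T = mx3 [:: [:: p; 0; - q]; [:: 0; a; 0]; [:: q; 0; r]] ->
  exists b', orthonormal_frame h b' /\
    mx_op b' T = mx3 [:: [:: a; 0; 0]; [:: 0; p; q]; [:: 0; - q; r]].
Proof.
move=> hb Tb.
pose Q : 'M[R]_3 := mx3 [:: [:: 0; 1; 0]; [:: 1; 0; 0]; [:: 0; 0; -1]].
apply: (orthonormal_change hb (Q := Q)).
  by rewrite mx3T !mx3M; apply: eq_mx3; ring.
by rewrite Tb !mx3M; apply: eq_mx3; ring.
Qed.

Lemma oneill_11_1_diag b p q r :
    orthonormal_frame h b ->
    mx_op b T = mx3 [:: [:: p; 0; 0]; [:: 0; q; 0]; [:: 0; 0; r]] ->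
  oneill_11_1 h T.
Proof. by move=> hb Tb; exists b; rewrite Tb mx3_diag. Qed.

Lemma oneill_11_1_spacelike b a p q r :
    orthonormal_frame h b ->
    mx_op b T = mx3 [:: [:: p; q; 0]; [:: q; r; 0]; [:: 0; 0; a]] ->
  oneill_11_1 h T.
Proof.
move=> hb Tb; have [C [S [CS qCS]]] := rotation_exists (p - r) q.
have [b' [hb' /=]] := rotation_frame hb Tb CS.
by rewrite qCS subrr; apply: oneill_11_1_diag.
Qed.

Section LorentzianBlock.
Variables (b : 3.-tuple g) (a p q r : R).
Hypothesis hb : orthonormal_frame h b.
Hypothesis Tb : mx_op b T = mx3 [:: [:: a; 0; 0]; [:: 0; p; q]; [:: 0; - q; r]].

Lemma oneill_11_1_block : 4 * q ^+ 2 < (p - r) ^+ 2 -> oneill_11_1 h T.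
Proof.
move=> /boost_exists[C [S [CS q'0]]]; have [b' [hb' /=]] := boost_frame hb Tb CS.
by rewrite q'0 oppr0; apply: oneill_11_1_diag.
Qed.

(* The boost equalizing the diagonal entries exists because [p - r] and [4 q]
   satisfy the strict inequality of [boost_exists]. *)
Lemma oneill_1zz_block : (p - r) ^+ 2 < 4 * q ^+ 2 -> oneill_1zz h T.
Proof.
move=> pr_lt; have [|C [S [CS p'r']]] := @boost_exists R (4 * q) (p - r).
  by rewrite exprMn -[4 ^+ 2]/(4 * 4 : R) -mulrA ltr_pM2l // ltr0n.
have [b' [hb' Tb']] := boost_frame hb Tb CS; exists b'; split=> //.
exists a, (p * C ^+ 2 + 2 * q * C * S - r * S ^+ 2).
exists ((p - r) * C * S + q * (C ^+ 2 + S ^+ 2)); split.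
  (* A boost preserves [(p - r)^2 - 4 q^2]. The new diagonal entries are equal, so a zero
     off-diagonal entry would make this negative quantity vanish. *)
  apply: contraTneq pr_lt => q'0; rewrite -leNgt -subr_ge0 le_eqVlt; apply/orP; left.
  apply/eqP; transitivity (((p - r) ^+ 2 - 4 * q ^+ 2) * (C ^+ 2 - S ^+ 2) ^+ 2).
    transitivity ((4 * q * C * S + (p - r) * (C ^+ 2 + S ^+ 2)) ^+ 2
      - 4 * ((p - r) * C * S + q * (C ^+ 2 + S ^+ 2)) ^+ 2); last by ring.
    by rewrite p'r' q'0; ring.
  by rewrite CS expr1n mulr1.
rewrite Tb'; apply: eq_mx3 => //; apply/subr0_eq/oppr_inj.
by rewrite oppr0 -p'r'; ring.
Qed.

Lemma oneill_21_block : (p - r) ^+ 2 = 4 * q ^+ 2 -> q != 0 -> oneill_21 h T.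
Proof.
move=> disc0 q0.
have [sg [sg1 pr]] : exists sg : R, (sg = 1 \/ sg = -1) /\ p = r + 2 * sg * q.
  have /eqP : (p - r) ^+ 2 = (2 * q) ^+ 2 by rewrite disc0; ring.
  rewrite eqf_sqr => /orP[] /eqP prE; [exists 1 | exists (-1)].
    by split; [left | rewrite -[p](subrK r) prE; ring].
  by split; [right | rewrite -[p](subrK r) prE; ring].
have sg2 : sg * sg = 1 by case: sg1 => ->; ring.
have sg0 : sg != 0 by case: sg1 => ->; rewrite ?oppr_eq0 oner_eq0.
(* [eps] is the sign of [sg * q], and [s] is scaled so that [sg * q = eps * s^2]. *)
have [s [eps [s0 eps1 qE]]] := neq0_square (mulf_neq0 sg0 q0).
have {}qE : q = sg * eps * s ^+ 2 by rewrite -mulrA -qE mulrA sg2 mul1r.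
(* The null vectors are [u = s (y2 - sg y3)], an eigenvector for [r + sg q], and
   [v = (y2 + sg y3) / (2 s)], for which [h u v = 1] and [T v = eps u + (r + sg q) v]. *)
pose Q := mx3 [:: [:: 1; 0; 0]; [:: 0; s; (2 * s)^-1]; [:: 0; - sg * s; sg / (2 * s)]].
pose A := mx3 [:: [:: a; 0; 0]; [:: 0; r + sg * q; eps]; [:: 0; 0; r + sg * q]].
have QG : Q^T *m gram h b *m Q = mx3 [:: [:: 1; 0; 0]; [:: 0; 0; 1]; [:: 0; 1; 0]].
  by rewrite hb.2 mx3T !mx3M; case: sg1 => ->; apply: eq_mx3; field.
have TQ : mx_op b T *m Q = Q *m A.
  by rewrite Tb pr /A qE !mx3M; case: sg1 => ->; apply: eq_mx3; field.
have [b' [b'P Gb' Tb']] := frame_change hb.1 unitmx_null QG TQ.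
by exists b'; split; [split | exists a, (r + sg * q), eps].
Qed.

(** The factor [k^2] is positive, so the sign of the simpler [delta] decides the type. *)
Lemma oneill_block k delta : (p - r) ^+ 2 - 4 * q ^+ 2 = k ^+ 2 * delta ->
  k != 0 -> q != 0 ->
  [/\ 0 < delta -> oneill_11_1 h T, delta < 0 -> oneill_1zz h T &
      delta = 0 -> oneill_21 h T].
Proof.
move=> disc k0 q0; have k2 : 0 < k ^+ 2 by rewrite lt_neqAle sqr_ge0 eq_sym sqrf_eq0 k0.
split=> [delta0|delta0|delta0].
- by apply: oneill_11_1_block; rewrite -subr_gt0 disc pmulr_rgt0.
- by apply: oneill_1zz_block; rewrite -subr_lt0 disc pmulr_rlt0.
- by apply: oneill_21_block => //; apply/subr0_eq; rewrite disc delta0 mulr0.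
Qed.

End LorentzianBlock.

End ONeill.

(** These rules let a proved first conjunct serve the others: the frame is used to compute the
    matrix, and the matrix to find the type. *)
Lemma and_dep (A B : Prop) : A -> (A -> B) -> A /\ B.
Proof. by move=> a /(_ a). Qed.

Lemma and3_dep (A B C : Prop) : A -> (A -> B) -> (A -> C) -> [/\ A, B & C].
Proof. by move=> a /(_ a) b /(_ a). Qed.

Lemma and4_dep (A B C D : Prop) :
  A -> (A -> [/\ B, C & D]) -> [/\ A, B, C & D].
Proof. by move=> a /(_ a)[]. Qed.

Ltac field_close := field; do ?[apply/andP; split].

(* [e] proves [x = x * u] for all [x], where [u = 1] holds in the context
   but is not a field identity. *)
Ltac field_mod e :=
  first [by field_close | by rewrite [LHS]e; field_close
        | by rewrite [RHS]e; field_close].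

Ltac gram_field hE e := rewrite ?symE ?hE; field_mod e.

(** First the nine structure constants fed to [formula] are checked, then the resulting matrix is
    compared with the stated one. *)
Ltac ricci_field formula bE hE e :=
  refine (etrans (formula _ _ _) _);
  [split; rewrite ?brE ?bE; gram_field hE e .. | apply: eq_mx3; field_mod e].

(* The matrix has eigenvalue [2 w^2 / mu^2] on the null vector [y2 + y3] and
   [- 2 w^2 / mu^2] on [y1 + s (y2 + y3)], where [s = - (1 + w) / (4 w)]; the null
   rotation fixing [y2 + y3] moves [y1] to the latter. *)
Lemma null_rotation (R : realType) (g : vectType R) (h : {symmetric g})
    (T : 'End(g)) (b : 3.-tuple g) (w mu : R) :
  orthonormal_frame h b -> w != 0 -> mu != 0 ->
  mx_op b T =
    mx3 [:: [:: - (2 * w ^+ 2 / mu ^+ 2); w * (1 + w) / mu ^+ 2;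
                - (w * (1 + w) / mu ^+ 2)];
            [:: w * (1 + w) / mu ^+ 2; w * (3 * w - 1) / (2 * mu ^+ 2);
                w * (1 + w) / (2 * mu ^+ 2)];
            [:: w * (1 + w) / mu ^+ 2; - (w * (1 + w) / (2 * mu ^+ 2));
                w * (1 + 5 * w) / (2 * mu ^+ 2)]] ->
  let q := (w ^+ 2 - 1) / (4 * mu ^+ 2) in
  exists b', orthonormal_frame h b' /\ mx_op b' T =
    mx3 [:: [:: - (2 * w ^+ 2 / mu ^+ 2); 0; 0];
            [:: 0; 2 * w ^+ 2 / mu ^+ 2 - q; q];
            [:: 0; - q; 2 * w ^+ 2 / mu ^+ 2 + q]].
Proof.
move=> hb w0 mu0 Tb q; pose s := - (1 + w) / (4 * w).
pose Q := mx3 [:: [:: 1; - s; s]; [:: s; 1 - s ^+ 2 / 2; s ^+ 2 / 2];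
                 [:: s; - (s ^+ 2 / 2); 1 + s ^+ 2 / 2]].
apply: (orthonormal_change hb (Q := Q)).
  by rewrite mx3T !mx3M; apply: eq_mx3; field.
by rewrite Tb !mx3M /s /q; apply: eq_mx3; field; apply/andP.
Qed.

Lemma basis_of_generating (R : fieldType) (g : vectType R) n (b b' : n.-tuple g) :
  basis_of fullv b -> (forall v, v \in b -> v \in <<b'>>%VS) ->
  basis_of fullv b'.
Proof.
move=> bP bb'; rewrite basisEdim size_tuple (size_basis bP) leqnn andbT.
by rewrite -(span_basis bP); apply/span_subvP.
Qed.

Theorem theorem3p15 (R : realType) (c : R) (c_lt1 : c < 1)
    (g : vectType R) (br : {bilinear g -> g -> g}) (br_lie : lie_bracket br)
    (x y z : g) (xyz_basis : basis_of fullv [tuple x; y; z])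
    (br_xy : br x y = 0) (br_zx : br z x = y)
    (br_zy : br z y = - c *: x + 2 *: y) :
  let w := Num.sqrt (1 - c) in
  let x1 := - (1 - w) *: x + y in
  let x2 := - (1 + w) *: x + y in
  let x3 := z in
  let P := mx3 [:: [:: 1 / (2 * w);    (1 + w) / (2 * w); 0];
                   [:: - 1 / (2 * w);  (w - 1) / (2 * w); 0];
                   [:: 0;              0;                 1]] in
  (* the parenthetical remarks on x1, x2, x3 and on the matrix of h *)
  [/\ basis_of fullv [tuple x1; x2; x3],
      br x1 x2 = 0, br x3 x1 = (1 + w) *: x1 & br x3 x2 = (1 - w) *: x2] /\
  forall h : {symmetric g}, lorentzian h ->
  let metric_is M := gram h [tuple x; y; z] = P^T *m M *m P in
  let Ric := ricci br h in
  let Ric_is b A := orthonormal_frame h b /\ mx_op b Ric = A in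
  (forall M, metric_is M <-> gram h [tuple x1; x2; x3] = M) /\
  (* (1) *)
  (metric_is (mx3 [:: [:: 0; 0; 1]; [:: 0; 1; 0]; [:: 1; 0; 0]]) ->
    [/\ Ric_is [tuple x2; (Num.sqrt 2)^-1 *: (x1 + x3);
                      (Num.sqrt 2)^-1 *: (x1 - x3)]
          (mx3 [:: [:: 0; 0; 0];
                   [:: 0; - (w * (w - 1)); w * (w - 1)];
                   [:: 0; - (w * (w - 1)); w * (w - 1)]]),
        w = 1 -> oneill_11_1 h Ric & w != 1 -> oneill_21 h Ric]) /\
  (* (2) *)
  (metric_is (mx3 [:: [:: 1; 0; 0]; [:: 0; 0; 1]; [:: 0; 1; 0]]) ->
    Ric_is [tuple x1; (Num.sqrt 2)^-1 *: (x2 + x3);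
                  (Num.sqrt 2)^-1 *: (x2 - x3)]
      (mx3 [:: [:: 0; 0; 0];
               [:: 0; - (w * (w + 1)); w * (w + 1)];
               [:: 0; - (w * (w + 1)); w * (w + 1)]]) /\
    oneill_21 h Ric) /\
  (* (3) *)
  (forall mu : R, 0 < mu ->
    metric_is (mx3 [:: [:: 1; 1; 0]; [:: 1; 1; mu]; [:: 0; mu; 0]]) ->
    [/\ Ric_is [tuple x1; x1 - x2 - (1 / (2 * mu)) *: x3;
                      x1 - x2 + (1 / (2 * mu)) *: x3]
          (mx3 [:: [:: - (2 * w ^+ 2 / mu ^+ 2);
                       w * (1 + w) / mu ^+ 2;
                       - (w * (1 + w) / mu ^+ 2)];
                   [:: w * (1 + w) / mu ^+ 2;
                       w * (3 * w - 1) / (2 * mu ^+ 2);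
                       w * (1 + w) / (2 * mu ^+ 2)];
                   [:: w * (1 + w) / mu ^+ 2;
                       - (w * (1 + w) / (2 * mu ^+ 2));
                       w * (1 + 5 * w) / (2 * mu ^+ 2)]]),
        w = 1 -> oneill_11_1 h Ric & w != 1 -> oneill_21 h Ric]) /\
  (* (4) *)
  (forall mu : R, 0 < mu ->
    metric_is (mx3 [:: [:: 1; 0; 0]; [:: 0; 1; 0]; [:: 0; 0; - mu]]) ->
    Ric_is [tuple x1; x2; (Num.sqrt mu)^-1 *: x3]
      (mx3 [:: [:: 2 * (1 + w) / mu; 0; 0];
               [:: 0; 2 * (1 - w) / mu; 0];
               [:: 0; 0; 2 * (1 + w ^+ 2) / mu]]) /\
    oneill_11_1 h Ric) /\
  (* (5) *)
  (forall mu : R, 0 < mu ->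
    metric_is (mx3 [:: [:: 1; 0; 0]; [:: 0; -1; 0]; [:: 0; 0; mu]]) ->
    Ric_is [tuple x1; (Num.sqrt mu)^-1 *: x3; x2]
      (mx3 [:: [:: - (2 * (1 + w) / mu); 0; 0];
               [:: 0; - (2 * (1 + w ^+ 2) / mu); 0];
               [:: 0; 0; - (2 * (1 - w) / mu)]]) /\
    oneill_11_1 h Ric) /\
  (* (6) *)
  (forall mu : R, 0 < mu ->
    metric_is (mx3 [:: [:: -1; 0; 0]; [:: 0; 1; 0]; [:: 0; 0; mu]]) ->
    Ric_is [tuple x2; (Num.sqrt mu)^-1 *: x3; x1]
      (mx3 [:: [:: 2 * (w - 1) / mu; 0; 0];
               [:: 0; - (2 * (1 + w ^+ 2) / mu); 0];
               [:: 0; 0; - (2 * (1 + w) / mu)]]) /\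
    oneill_11_1 h Ric) /\
  (* (7) *)
  (forall mu : R, 0 < mu ->
    metric_is (mx3 [:: [:: 0; 1; 0]; [:: 1; 0; 0]; [:: 0; 0; mu]]) ->
    Ric_is [tuple (Num.sqrt mu)^-1 *: x3; (Num.sqrt 2)^-1 *: (x1 + x2);
                  (Num.sqrt 2)^-1 *: (x1 - x2)]
      (mx3 [:: [:: - (2 / mu); 0; 0];
               [:: 0; - (2 / mu); 0];
               [:: 0; 0; - (2 / mu)]]) /\
    oneill_11_1 h Ric) /\
  (* (8) *)
  (forall mu : R, 0 < mu ->
    metric_is (mx3 [:: [:: 0; 1; 0]; [:: 1; 1; 0]; [:: 0; 0; mu]]) ->
    [/\ Ric_is [tuple (Num.sqrt mu)^-1 *: x3; x2; x1 - x2]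
          (mx3 [:: [:: - (2 / mu); 0; 0];
                   [:: 0; - (2 * (w ^+ 2 - w + 1) / mu);
                       2 * w * (w - 1) / mu];
                   [:: 0; - (2 * w * (w - 1) / mu);
                       2 * (w ^+ 2 - w - 1) / mu]]),
        w = 1 -> oneill_11_1 h Ric & w != 1 -> oneill_21 h Ric]) /\
  (* (9) *)
  (forall mu : R, 0 < mu ->
    metric_is (mx3 [:: [:: 0; 1; 0]; [:: 1; -1; 0]; [:: 0; 0; mu]]) ->
    [/\ Ric_is [tuple (Num.sqrt mu)^-1 *: x3; x1 + x2; x2]
          (mx3 [:: [:: - (2 / mu); 0; 0];
                   [:: 0; 2 * (w ^+ 2 - w - 1) / mu;
                       2 * w * (w - 1) / mu];
                   [:: 0; - (2 * w * (w - 1) / mu);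
                       - (2 * (w ^+ 2 - w + 1) / mu)]]),
        w = 1 -> oneill_11_1 h Ric & w != 1 -> oneill_21 h Ric]) /\
  (* (10-1) *)
  (forall nu tau : R, 0 < nu -> tau < 1 ->
    metric_is (mx3 [:: [:: 1; 1; 0]; [:: 1; tau; 0]; [:: 0; 0; nu]]) ->
    let s := Num.sqrt (1 - tau) in
    let delta := tau * (tau - 1 + w ^+ 2) in
    [/\ Ric_is [tuple x1; (Num.sqrt nu)^-1 *: x3; s^-1 *: (x1 - x2)]
          (mx3 [:: [:: - (2 * (w ^+ 2 + w + 1 - (1 + w) * tau)
                           / (nu * (1 - tau)));
                       0;
                       - (2 * w * (1 + w) / (nu * s))];
                   [:: 0;
                       2 * (w ^+ 2 * tau + tau - 1) / (nu * (1 - tau));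
                       0];
                   [:: 2 * w * (1 + w) / (nu * s);
                       0;
                       2 * (w ^+ 2 + w - 1 + (1 - w) * tau)
                         / (nu * (1 - tau))]]),
        0 < delta -> oneill_11_1 h Ric,
        delta < 0 -> oneill_1zz h Ric &
        delta = 0 -> oneill_21 h Ric]) /\
  (* (10-2) *)
  (forall nu tau : R, nu < 0 -> 1 < tau ->
    metric_is (mx3 [:: [:: 1; 1; 0]; [:: 1; tau; 0]; [:: 0; 0; nu]]) ->
    let s := Num.sqrt (tau - 1) in
    Ric_is [tuple x1; s^-1 *: (x1 - x2); (Num.sqrt (- nu))^-1 *: x3]
      (mx3 [:: [:: 2 * (w ^+ 2 + w + 1 - (1 + w) * tau) / (nu * (tau - 1));
                   - (2 * w * (1 + w) / (nu * s));
                   0];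
               [:: - (2 * w * (1 + w) / (nu * s));
                   - (2 * (w ^+ 2 + w - 1 + (1 - w) * tau)
                       / (nu * (tau - 1)));
                   0];
               [:: 0;
                   0;
                   - (2 * (w ^+ 2 * tau + tau - 1) / (nu * (tau - 1)))]]) /\
    oneill_11_1 h Ric) /\
  (* (11) *)
  (forall mu eta : R, 0 < mu -> eta < 1 ->
    metric_is (mx3 [:: [:: -1; 1; 0]; [:: 1; - eta; 0]; [:: 0; 0; mu]]) ->
    let s := Num.sqrt (1 - eta) in
    let delta := eta * (eta - 1 + w ^+ 2) in
    [/\ Ric_is [tuple (Num.sqrt mu)^-1 *: x3; s^-1 *: (x1 + x2); x1]
          (mx3 [:: [:: 2 * (w ^+ 2 * eta + eta - 1) / (mu * (1 - eta)); 0; 0];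
                   [:: 0;
                       2 * (w ^+ 2 + w - 1 + eta - w * eta)
                         / (mu * (1 - eta));
                       2 * w * (1 + w) / (mu * s)];
                   [:: 0;
                       - (2 * w * (1 + w) / (mu * s));
                       - (2 * (w ^+ 2 + w + 1 - (1 + w) * eta)
                           / (mu * (1 - eta)))]]),
        0 < delta -> oneill_11_1 h Ric,
        delta < 0 -> oneill_1zz h Ric &
        delta = 0 -> oneill_21 h Ric]).
Proof.
move=> w x1 x2 x3 P.

(* The basis [x1, x2, x3] and its brackets *)
have w0 : 0 < w by rewrite sqrtr_gt0 subr_gt0.
have w_neq0 : w != 0 by rewrite gt_eqF.
have cE : c = 1 - w ^+ 2 by rewrite sqr_sqrtr ?subr_ge0 1?ltW // subKr.
have alt : forall u, br u u = 0 := br_lie.1.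
have yx : br y x = 0 by rewrite (br_anti alt) br_xy oppr0.
have b12 : br x1 x2 = 0 by rewrite !brE !alt yx br_xy !(scaler0, addr0).
have b31 : br x3 x1 = (1 + w) *: x1.
  rewrite !brE br_zx br_zy cE scalerDr scalerA addrCA -scalerDl.
  by congr (_ *: _ + _ *: _); ring.
have b32 : br x3 x2 = (1 - w) *: x2.
  rewrite !brE br_zx br_zy cE scalerDr scalerA addrCA -scalerDl.
  by congr (_ *: _ + _ *: _); ring.
have x12P : basis_of fullv [tuple x1; x2; x3].
  apply: basis_of_generating xyz_basis _.
  have m1 : x1 \in <<[tuple x1; x2; x3]>>%VS by rewrite memv_span ?inE ?eqxx.
  have m2 : x2 \in <<[tuple x1; x2; x3]>>%VS by rewrite memv_span ?inE ?eqxx ?orbT.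
  have xE : x = (2 * w)^-1 *: (x1 - x2).
    rewrite /x1 /x2 (opprD (_ *: x)) addrACA subrr addr0 -scalerBl scalerA.
    by rewrite -[LHS]scale1r; congr (_ *: _); field.
  have mx : x \in <<[tuple x1; x2; x3]>>%VS by rewrite xE memvZ // memvB.
  move=> v; rewrite !inE => /or3P[] /eqP -> //.
    by rewrite -[y](addKr (- (1 - w) *: x)) memvD // memvN memvZ.
  by rewrite memv_span ?inE ?eqxx ?orbT.
split=> // h hL metric_is Ric Ric_is.

(* The metric in the basis [x1, x2, x3] *)
have metricP M : metric_is M <-> gram h [tuple x1; x2; x3] = M.
  (* The columns of [Q] are the coordinates of [x1, x2, x3] in [x, y, z], and [P] is its inverse. *)
  pose Q := mx3 [:: [:: - (1 - w); - (1 + w); 0]; [:: 1; 1; 0]; [:: 0; 0; 1]].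
  have PQ : P *m Q = 1%:M by rewrite mx3M mx3_1; apply: eq_mx3; field.
  have -> : gram h [tuple x1; x2; x3] = Q^T *m gram h [tuple x; y; z] *m Q.
    rewrite !gram3E mx3T !mx3M (symC h y x) !(symC h z).
    by apply: eq_mx3; rewrite ?symE ?(symC h y x) ?(symC h z); ring.
  split=> [-> | <-].
    by rewrite !mulmxA -trmx_mul PQ trmx1 mul1mx -mulmxA PQ mulmx1.
  have QP := mulmx1C PQ.
  by rewrite /metric_is !mulmxA -trmx_mul QP trmx1 mul1mx -mulmxA QP mulmx1.
split=> //.
(* From here on [w] is just a positive number, and the [x_i] are known by their brackets and Gram
   matrix. *)
clearbody metric_is x1 x2 x3; clearbody P; clearbody w; clear cE.
have b21 : br x2 x1 = 0 by rewrite (br_anti alt) b12 oppr0.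
have b13 : br x1 x3 = - ((1 + w) *: x1) by rewrite (br_anti alt) b31.
have b23 : br x2 x3 = - ((1 - w) *: x2) by rewrite (br_anti alt) b32.
pose ricciE := @ricci_orthonormal _ _ br h hL alt.
pose bE := (alt, b12, b21, (b13, b31), (b23, b32)).
have [t [t0 tE ->]] := @pos_square R 2 (ltr0n _ 2).
have t_neq0 : t != 0 by rewrite gt_eqF.
(* Below, [s] stands for the inverse of the square root of 2, known only through [2 s^2 = 1], which
   [m2] supplies; [m1] is the trivial analogue where that root does not occur. *)
have m2 u : u = u * (2 * t^-1 ^+ 2).
  by rewrite [in X in _ * X]tE -exprMn mulfV // expr1n mulr1.
have m1 u : u = u * 1 :> R by rewrite mulr1.
move: (t^-1) m2 => s m2.

(* Metrics degenerate on the abelian ideal spanned by [x1, x2] *)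
split.
  move=> /metricP/gram3_inj[[h11 h12 h13] [[h21 h22 h23] [h31 h32 h33]]].
  pose hE := ((h11, h12, h13), (h21, h22, h23), (h31, h32, h33)).
  apply: and3_dep.
  - apply: and_dep => [|hb]; first by apply: (orthonormal_frameI hL); gram_field hE m2.
    (* The nine constants are the coordinates of [[y1, y2]], [[y1, y3]], [[y2, y3]], here as in
       every later case. Here [[y2, y3] = (1 + w) x1] and [x1 = s (y2 + y3)]. *)
    ricci_field (ricciE _ _ _ (- (s * (1 - w))) 0 0
      (s * (1 - w)) 0 0 0 (s * (1 + w)) (s * (1 + w)) hb) bE hE m2.
  - move=> [hb Rb] w1; apply: (@oneill_11_1_diag _ _ _ _ _ 0 0 0 hb).
    by rewrite Rb w1; apply: eq_mx3; ring.
  - move=> [hb Rb] w1.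
    have q0 : w * (w - 1) != 0 by rewrite mulf_neq0 // subr_eq0.
    (* The block has [p = -q] and [r = q], so its discriminant vanishes. *)
    by apply: (oneill_21_block hb Rb) => //; ring.
split.
  move=> /metricP/gram3_inj[[h11 h12 h13] [[h21 h22 h23] [h31 h32 h33]]].
  pose hE := ((h11, h12, h13), (h21, h22, h23), (h31, h32, h33)).
  apply: and_dep.
  - apply: and_dep => [|hb]; first by apply: (orthonormal_frameI hL); gram_field hE m2.
    ricci_field (ricciE _ _ _ (- (s * (1 + w))) 0 0
      (s * (1 + w)) 0 0 0 (s * (1 - w)) (s * (1 - w)) hb) bE hE m2.
  - move=> [hb Rb].
    have q0 : w * (w + 1) != 0 by rewrite mulf_neq0 // gt_eqF // ltr_wpDl ?ltW.
    by apply: (oneill_21_block hb Rb) => //; ring.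
split.
  move=> mu mu0; have mu_neq0 : mu != 0 by rewrite gt_eqF.
  move=> /metricP/gram3_inj[[h11 h12 h13] [[h21 h22 h23] [h31 h32 h33]]].
  pose hE := ((h11, h12, h13), (h21, h22, h23), (h31, h32, h33)).
  apply: and3_dep.
  - apply: and_dep => [|hb]; first by apply: (orthonormal_frameI hL); gram_field hE m1.
    (* The last bracket uses [x2 = y1 - (y2 + y3) / 2]. *)
    ricci_field (ricciE _ _ _ ((1 + w) / (2 * mu)) 0 0
      (- ((1 + w) / (2 * mu))) 0 0 (- (2 * w / mu))
      (- ((1 - w) / (2 * mu))) (- ((1 - w) / (2 * mu))) hb)
      bE hE m1.
  - move=> [hb Rb] w1; have [b' [hb' Rb']] := null_rotation hb w_neq0 mu_neq0 Rb.
    apply: (@oneill_11_1_diag _ _ _ _ _ (- (2 / mu ^+ 2)) (2 / mu ^+ 2)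
      (2 / mu ^+ 2) hb').
    by rewrite Rb' w1; apply: eq_mx3; field.
  - move=> [hb Rb] w1; have [b' [hb' Rb']] := null_rotation hb w_neq0 mu_neq0 Rb.
    (* After the null rotation [p - r = - 2 q] with [q = (w^2 - 1) / (4 mu^2)], nonzero since [w] is
       positive and not 1. *)
    apply: (oneill_21_block hb' Rb'); first by field.
    have w2 : w ^+ 2 - 1 != 0.
      by rewrite subr_eq0 sqrf_eq1 negb_or w1 gt_eqF // (lt_trans _ w0) // ltrN10.
    by rewrite mulf_neq0 // invr_eq0 mulf_neq0 ?expf_neq0 ?pnatr_eq0.

(* Metrics for which [x1, x2, x3] are orthogonal *)
split.
  (* Replacing [mu] by [n^2] and its square root by [n] makes all identities rational. *)
  move=> mu /pos_square[n [n0 -> ->]]; have n_neq0 : n != 0 by rewrite gt_eqF.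
  move=> /metricP/gram3_inj[[h11 h12 h13] [[h21 h22 h23] [h31 h32 h33]]].
  pose hE := ((h11, h12, h13), (h21, h22, h23), (h31, h32, h33)).
  apply: and_dep; last by move=> [hb Rb]; apply: (oneill_11_1_diag hb Rb).
  apply: and_dep => [|hb]; first by apply: (orthonormal_frameI hL); gram_field hE m1.
  ricci_field (ricciE _ _ _ 0 0 0
      (- ((1 + w) / n)) 0 0 0 (- ((1 - w) / n)) 0 hb)
      bE hE m1.
split.
  move=> mu /pos_square[n [n0 -> ->]]; have n_neq0 : n != 0 by rewrite gt_eqF.
  move=> /metricP/gram3_inj[[h11 h12 h13] [[h21 h22 h23] [h31 h32 h33]]].
  pose hE := ((h11, h12, h13), (h21, h22, h23), (h31, h32, h33)).
  apply: and_dep; last by move=> [hb Rb]; apply: (oneill_11_1_diag hb Rb).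
  apply: and_dep => [|hb]; first by apply: (orthonormal_frameI hL); gram_field hE m1.
  ricci_field (ricciE _ _ _ (- ((1 + w) / n)) 0 0
      0 0 0 0 0 ((1 - w) / n) hb)
      bE hE m1.
split.
  move=> mu /pos_square[n [n0 -> ->]]; have n_neq0 : n != 0 by rewrite gt_eqF.
  move=> /metricP/gram3_inj[[h11 h12 h13] [[h21 h22 h23] [h31 h32 h33]]].
  pose hE := ((h11, h12, h13), (h21, h22, h23), (h31, h32, h33)).
  apply: and_dep; last by move=> [hb Rb]; apply: (oneill_11_1_diag hb Rb).
  apply: and_dep => [|hb]; first by apply: (orthonormal_frameI hL); gram_field hE m1.
  ricci_field (ricciE _ _ _ (- ((1 - w) / n)) 0 0
      0 0 0 0 0 ((1 + w) / n) hb)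
      bE hE m1.

(* Metrics with [x1] null and [x3] orthogonal to [x1, x2] *)
split.
  move=> mu /pos_square[n [n0 -> ->]]; have n_neq0 : n != 0 by rewrite gt_eqF.
  move=> /metricP/gram3_inj[[h11 h12 h13] [[h21 h22 h23] [h31 h32 h33]]].
  pose hE := ((h11, h12, h13), (h21, h22, h23), (h31, h32, h33)).
  apply: and_dep; last by move=> [hb Rb]; apply: (oneill_11_1_diag hb Rb).
  apply: and_dep => [|hb]; first by apply: (orthonormal_frameI hL); gram_field hE m2.
  (* On the plane of [y2, y3], [ad x3] is the identity plus [w] times the boost generator exchanging
     [y2] and [y3]. *)
  ricci_field (ricciE _ _ _ 0 n^-1 (w / n)
      0 (w / n) n^-1 0 0 0 hb)
      bE hE m2.
split.
  move=> mu /pos_square[n [n0 -> ->]]; have n_neq0 : n != 0 by rewrite gt_eqF.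
  move=> /metricP/gram3_inj[[h11 h12 h13] [[h21 h22 h23] [h31 h32 h33]]].
  pose hE := ((h11, h12, h13), (h21, h22, h23), (h31, h32, h33)).
  apply: and3_dep.
  - apply: and_dep => [|hb]; first by apply: (orthonormal_frameI hL); gram_field hE m1.
    ricci_field (ricciE _ _ _ 0 ((1 - w) / n) 0
      0 (2 * w / n) ((1 + w) / n) 0 0 0 hb)
      bE hE m1.
  - move=> [hb Rb] w1; apply: (@oneill_11_1_diag _ _ _ _ _ (- (2 / n ^+ 2))
      (- (2 / n ^+ 2)) (- (2 / n ^+ 2)) hb).
    by rewrite Rb w1; apply: eq_mx3; field.
  - move=> [hb Rb] w1; apply: (oneill_21_block hb Rb); first by field.
    by rewrite !mulf_neq0 ?invr_eq0 ?expf_neq0 ?subr_eq0 ?pnatr_eq0.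
split.
  move=> mu /pos_square[n [n0 -> ->]]; have n_neq0 : n != 0 by rewrite gt_eqF.
  move=> /metricP/gram3_inj[[h11 h12 h13] [[h21 h22 h23] [h31 h32 h33]]].
  pose hE := ((h11, h12, h13), (h21, h22, h23), (h31, h32, h33)).
  apply: and3_dep.
  - apply: and_dep => [|hb]; first by apply: (orthonormal_frameI hL); gram_field hE m1.
    ricci_field (ricciE _ _ _ 0 ((1 + w) / n) (- (2 * w / n))
      0 0 ((1 - w) / n) 0 0 0 hb)
      bE hE m1.
  - move=> [hb Rb] w1; apply: (@oneill_11_1_diag _ _ _ _ _ (- (2 / n ^+ 2))
      (- (2 / n ^+ 2)) (- (2 / n ^+ 2)) hb).
    by rewrite Rb w1; apply: eq_mx3; field.
  - move=> [hb Rb] w1; apply: (oneill_21_block hb Rb); first by field.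
    by rewrite !mulf_neq0 ?invr_eq0 ?expf_neq0 ?subr_eq0 ?pnatr_eq0.

(* Families in which [x1] is not null and not orthogonal to [x2] *)
split.
  move=> nu tau /pos_square[n [n0 -> ->]] tau1.
  have n_neq0 : n != 0 by rewrite gt_eqF.
  have [|d [d0 dE ->]] := @pos_square _ (1 - tau); first by rewrite subr_gt0.
  have d_neq0 : d != 0 by rewrite gt_eqF.
  have -> : tau = 1 - d ^+ 2 by rewrite -dE subKr.
  rewrite subKr.
  move=> /metricP/gram3_inj[[h11 h12 h13] [[h21 h22 h23] [h31 h32 h33]]].
  pose hE := ((h11, h12, h13), (h21, h22, h23), (h31, h32, h33)).
  move=> s' delta; rewrite {}/s'; apply: and4_dep.
  - apply: and_dep => [|hb]; first by apply: (orthonormal_frameI hL); gram_field hE m1.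
    (* The last bracket uses [x2 = y1 - d y3]. *)
    ricci_field (ricciE _ _ _ (- ((1 + w) / n)) 0 0
      0 0 0 (2 * w / (n * d)) 0 ((1 - w) / n) hb)
      bE hE m1.
  - move=> [hb Rb]; have [b' [hb' Rb']] := swap_frame hb Rb.
    (* Up to sign [p - r] is [4 w (w + d^2) / (n d)^2], and [(w + d^2)^2 - (1 + w)^2 d^2 = (1 - d^2)
       (w^2 - d^2)], which is [delta]. *)
    apply: (oneill_block hb' Rb' (k := 4 * w / (n * d) ^+ 2)).
    + by rewrite /delta; field_close.
    + by rewrite !mulf_neq0 ?invr_eq0 ?expf_neq0 ?mulf_neq0 ?pnatr_eq0.
    + by rewrite !mulf_neq0 ?invr_eq0 ?mulf_neq0 ?expf_neq0 ?pnatr_eq0 // gt_eqF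
        ?addr_gt0.
split.
  move=> nu tau nu0 tau1.
  have [|n [n0 nE ->]] := @pos_square _ (- nu); first by rewrite oppr_gt0.
  have n_neq0 : n != 0 by rewrite gt_eqF.
  have [|d [d0 dE ->]] := @pos_square _ (tau - 1); first by rewrite subr_gt0.
  have d_neq0 : d != 0 by rewrite gt_eqF.
  have -> : nu = - n ^+ 2 by rewrite -nE opprK.
  have -> : tau = 1 + d ^+ 2 by rewrite -dE addrC subrK.
  rewrite [1 + _ - 1]addrC addKr.
  move=> /metricP/gram3_inj[[h11 h12 h13] [[h21 h22 h23] [h31 h32 h33]]].
  pose hE := ((h11, h12, h13), (h21, h22, h23), (h31, h32, h33)).
  move=> s'; rewrite {}/s'; apply: and_dep; last first.
    (* Here the plane of [x1, x2] is spacelike and invariant under the Ricci operator. *)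
    by move=> [hb Rb]; apply: (oneill_11_1_spacelike hb Rb).
  apply: and_dep => [|hb]; first by apply: (orthonormal_frameI hL); gram_field hE m1.
  ricci_field (ricciE _ _ _ 0 0 0
      (- ((1 + w) / n)) 0 0 (- (2 * w / (n * d))) (- ((1 - w) / n)) 0 hb)
      bE hE m1.
move=> mu eta /pos_square[n [n0 -> ->]] eta1.
  have n_neq0 : n != 0 by rewrite gt_eqF.
have [|d [d0 dE ->]] := @pos_square _ (1 - eta); first by rewrite subr_gt0.
have d_neq0 : d != 0 by rewrite gt_eqF.
have -> : eta = 1 - d ^+ 2 by rewrite -dE subKr.
rewrite subKr.
move=> /metricP/gram3_inj[[h11 h12 h13] [[h21 h22 h23] [h31 h32 h33]]].
pose hE := ((h11, h12, h13), (h21, h22, h23), (h31, h32, h33)).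
move=> s' delta; rewrite {}/s'; apply: and4_dep.
- apply: and_dep => [|hb]; first by apply: (orthonormal_frameI hL); gram_field hE m1.
  (* The first bracket uses [x2 = d y2 - y3]. *)
  ricci_field (ricciE _ _ _ 0 ((1 - w) / n) (2 * w / (n * d))
    0 0 ((1 + w) / n) 0 0 0 hb)
    bE hE m1.
- move=> [hb Rb]; apply: (oneill_block hb Rb (k := 4 * w / (n * d) ^+ 2)).
  + by rewrite /delta; field_close.
  + by rewrite !mulf_neq0 ?invr_eq0 ?expf_neq0 ?mulf_neq0 ?pnatr_eq0.
  + by rewrite !mulf_neq0 ?invr_eq0 ?mulf_neq0 ?expf_neq0 ?pnatr_eq0 // gt_eqF
        ?addr_gt0.
Qed.
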